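(* Every minimally $\gamma_g$-imperfect graph $G$ satisfies $\gamma(G)=2$.
   Context: Graphs are finite, simple, undirected, with at least one vertex, not necessarily connected. $\gamma(G)$ is the domination number of $G$. Domination game on $G$: Dominator and Staller alternately select vertices; each selected vertex must dominate (i.e. contain in its closed neighborhood) at least one vertex not dominated by the previously selected vertices. The game ends when no legal move exists. Dominator wants to minimize and Staller to maximize the total number of moves. $\gamma_g(G)$ is the number of moves under optimal play when Dominator starts. $G$ is $\gamma_g$-perfect if every induced subgraph $F$ of $G$ satisfies $\gamma_g(F)=\gamma(F)$. $G$ is minimally $\gamma_g$-imperfect if each of its proper induced subgraphs is $\gamma_g$-perfect but $\gamma(G)<\gamma_g(G)$. *)

(* Defs.v *)
From mathcomp Require Import all_boot.

Set Implicit Arguments.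
Unset Strict Implicit.
Unset Printing Implicit Defensive.

Record sgraph := SGraph {
  vertex :> finType;
  adj : rel vertex;
  adj_sym : symmetric adj;
  adj_irrefl : irreflexive adj
}.

Section Induced.
Variables (G : sgraph) (S : {set G}).

Definition induced_adj : rel {x : G | x \in S} :=
  fun x y => adj (val x) (val y).

Lemma induced_adj_sym : symmetric induced_adj.
Proof. by move=> x y; apply: adj_sym. Qed.

Lemma induced_adj_irrefl : irreflexive induced_adj.
Proof. by move=> x; apply: adj_irrefl. Qed.

Definition induced : sgraph := SGraph induced_adj_sym induced_adj_irrefl.
End Induced.

Section Domination.
Variable G : sgraph.
Implicit Types (A : {set G}) (v : G).

Definition closed_nbhd v : {set G} := [set u | (u == v) || adj v u].

Definition dominated A : {set G} := \bigcup_(v in A) closed_nbhd v.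

Definition dominating A : bool := dominated A == [set: G].

Definition domination_number : nat :=
  #|[arg min_(A < [set: G] | dominating A) #|A|]|.

(* A is the set of vertices selected so far. *)
Definition legal A v : bool := ~~ (closed_nbhd v \subset dominated A).

(* Number of moves still to be played under optimal play once the vertices of
   A have been selected; dom tells whether Dominator is to move. The first
   argument bounds the recursion: it is large enough as soon as it is at least
   the number of unselected vertices, see game_value_recE. The default value of
   the minimum is itself the value of a legal move. *)
Fixpoint game_value_rec (n : nat) (dom : bool) A : nat :=
  if n is n'.+1 then
    let F v := game_value_rec n' (~~ dom) (v |: A) in
    if [pick v | legal A v] is Some v0 then
      (if dom then \big[minn/F v0]_(v | legal A v) F v
       else \max_(v | legal A v) F v).+1
    else 0
  else 0.

Definition game_value (dom : bool) A : nat := game_value_rec #|~: A| dom A.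

Definition game_domination_number : nat := game_value true set0.

Lemma legal_notin A v : legal A v -> v \notin A.
Proof. by apply: contraNN => vA; apply: (bigcup_sup v vA). Qed.

Lemma game_value_recE n dom A :
  #|~: A| <= n -> game_value_rec n dom A = game_value dom A.
Proof.
have gen m k d B : #|~: B| <= m -> #|~: B| <= k ->
    game_value_rec m d B = game_value_rec k d B.
  have no_move C : #|~: C| <= 0 -> [pick v | legal C v] = None.
    rewrite leqn0 cards_eq0 => /eqP C0; case: (pickP (legal C)) => [v /legal_notin|//].
    by rewrite -in_setC C0 inE.
  elim: m k d B => [|m IH] [|k] d B hm hk /=; [by [] | by rewrite no_move | by rewrite no_move | ].
  have step v : legal B v -> game_value_rec m (~~ d) (v |: B)
                           = game_value_rec k (~~ d) (v |: B).
    move=> /legal_notin vB.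
    have : #|~: (v |: B)| < #|~: B|.
      apply: proper_card; rewrite properC properE subsetUr.
      by apply/subsetPn; exists v; rewrite // setU11.
    by move=> lt; apply: IH; rewrite -ltnS; apply: leq_trans lt _.
  by case: (pickP (legal B)) => [v0 v0B|//]; case: d step => step;
    congr _.+1; rewrite ?(step v0) //; apply: eq_bigr => v; apply: step.
by move=> le; apply: gen.
Qed.

Lemma game_valueE dom A :
  game_value dom A =
    let F v := game_value (~~ dom) (v |: A) in
    if [pick v | legal A v] is Some v0 then
      (if dom then \big[minn/F v0]_(v | legal A v) F v
       else \max_(v | legal A v) F v).+1
    else 0.
Proof.
have lec v : #|~: (v |: A)| <= #|~: A|.
  by apply: subset_leq_card; rewrite setCS subsetUr.
rewrite -(@game_value_recE #|~: A|.+1) //=.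
case: (pickP (legal A)) => [v0 _|//]; rewrite !game_value_recE //.
by case: dom; congr _.+1; apply: eq_bigr => v _; rewrite game_value_recE.
Qed.

End Domination.

Definition game_perfect (G : sgraph) : Prop :=
  forall S : {set G}, S != set0 ->
    game_domination_number (induced S) = domination_number (induced S).

Definition minimally_game_imperfect (G : sgraph) : Prop :=
  (forall S : {set G}, S != set0 -> S \proper [set: G] ->
     game_perfect (induced S)) /\
  domination_number G < game_domination_number G.

(* Main.v *)
Require Import Defs.
From mathcomp Require Import all_boot order.

(** Call [w] a pivot of a vertex set [S] when the vertices of [S] outside
    [N[w]] split into [|X|] classes such that every further legal move
    dominates exactly one class.  If [|X| < gamma(S)], Dominator plays [w] and
    the rest of the game lasts at most [|X|] moves whatever the players do, so
    the game on [S] takes [gamma(S)] moves.  For domination number 2,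
    [gamma_g = 2] says precisely that there is a pivot with [|X| <= 1].

    Pivots with [|X| < gamma] exist in every graph all of whose induced
    subgraphs of domination number 2 have them, by induction on
    [gamma(S) = k + 1]: among the minimum dominating sets [d + Y] of [S] with a
    distinguished element [d], take one for which [W = S \ N[Y]] is smallest.
    The set [F = S \ W] has domination number [k], hence a pivot [v] with
    classes [X].  Minimality of [W] forces that no vertex sees both [W] and
    [U = F \ N[v]].  Then [S \ U] has domination number 2, and its pivot [w]
    is a pivot of [S] with one class more than [X], since otherwise two
    classes could be dominated at once and [S] would have a dominating set of
    size [k]. *)

Set Implicit Arguments.
Unset Strict Implicit.
Unset Printing Implicit Defensive.

Local Notation N := closed_nbhd.

Lemma bigminn_le_cond (I : finType) (P : pred I) (F : I -> nat) m j :
  P j -> \big[minn/m]_(i | P i) F i <= F j.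
Proof. exact: (@Order.TotalTheory.bigmin_le_cond _ nat I m j P F). Qed.

(** * Closed neighbourhoods, relative domination and pivots *)

Section Pivots.
Variable G : sgraph.
Implicit Types (S T X Y Z A : {set G}) (p q v w x : G).

Lemma nbhd_refl v : v \in N v.
Proof. by rewrite inE eqxx. Qed.

Lemma nbhd_sym u v : (u \in N v) = (v \in N u).
Proof. by rewrite !inE eq_sym adj_sym. Qed.

Lemma dominatedP A q : reflect (exists2 v, v \in A & q \in N v) (q \in dominated A).
Proof. exact: bigcupP. Qed.

Lemma sub_dominated A : A \subset dominated A.
Proof. by apply/subsetP => v vA; apply/dominatedP; exists v => //; apply: nbhd_refl. Qed.

Lemma dominatedU1 v A : dominated (v |: A) = N v :|: dominated A.
Proof. by rewrite /dominated bigcup_setU big_set1. Qed.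

Lemma legalP A v : reflect (exists2 q, q \in N v & q \notin dominated A) (legal A v).
Proof. exact: subsetPn. Qed.

(** Requiring [Y \subset S] makes this a bound on the domination number of the subgraph induced by
    [S], without leaving the vertex type of [G]. *)
Definition dominable S k :=
  exists Y, [/\ Y \subset S, #|Y| <= k & S \subset dominated Y].

(** The classes are traces of closed neighbourhoods on [S :\: N w], and [X] holds representatives of
    them; [#|X|] only bounds their number. *)
Definition pivot S w X :=
  [/\ w \in S, X \subset S &
      forall p q, p \in S -> q \in S -> q \in N p -> q \notin N w ->
        exists2 x, x \in X &
          forall r, r \in S -> r \notin N w -> (r \in N p) = (r \in N x)].

(** A vertex [q] of [S] outside [N w] sees itself, so the representative of its trace sees [q]. *)
Lemma pivot_dominated S w X : pivot S w X -> S \subset dominated (w |: X).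
Proof.
case=> wS XS hX; apply/subsetP => q qS; rewrite dominatedU1 inE.
case: (boolP (q \in N w)) => //= qw.
have [x xX hx] := hX q q qS qS (nbhd_refl q) qw.
by apply/dominatedP; exists x; rewrite // -hx // nbhd_refl.
Qed.

(** * Induction step: from domination number k+1 to k+2 *)

Section Step.
Variables (S : {set G}) (k : nat).
Hypothesis S_min : ~ dominable S k.+1.

Variables (Y : {set G}) (d : G).
Hypotheses (YS : Y \subset S) (Yk : #|Y| <= k.+1) (dS : d \in S).
Hypothesis dY_dom : S \subset dominated (d |: Y).
Hypothesis Y_min : forall Z, Z \subset S -> #|Z| <= k.+1 ->
  S \subset dominated (d |: Z) ->
  #|S :\: dominated Y| <= #|S :\: dominated Z|.

Let F := S :&: dominated Y.

Let FS : F \subset S.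
Proof. exact: subsetIl. Qed.

Lemma far_dominated q : q \in S -> q \notin F -> q \in N d.
Proof.
move=> qS; rewrite inE qS /= => qY; have := subsetP dY_dom q qS.
by rewrite dominatedU1 inE (negPf qY) orbF.
Qed.

Lemma cover_dominable : dominable F k.+1.
Proof.
exists Y; split=> //; last exact: subsetIr.
by apply/subsetP => y yY; rewrite inE (subsetP YS) // (subsetP (sub_dominated Y)).
Qed.

Lemma dominated_far_or Z : F \subset dominated Z -> S \subset dominated (d |: Z).
Proof.
move=> FZ; apply/subsetP => q qS; rewrite dominatedU1 inE.
case: (boolP (q \in F)) => [/(subsetP FZ) ->|/(far_dominated qS) -> //].
by rewrite orbT.
Qed.

Lemma cover_not_dominable : ~ dominable F k.
Proof.
case=> Z [ZF Zk FZ]; apply: S_min; exists (d |: Z); split.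
- by rewrite subUset sub1set dS (subset_trans ZF).
- by rewrite cardsU1; case: (_ \notin _) => //=; apply: ltnW.
- exact: dominated_far_or.
Qed.

(** [Z] competes with [Y] in [Y_min]: what it leaves undominated in [S] lies in [S :\: F] and is at
    least as large, hence equal to it. *)
Lemma cover_maximal Z q : Z \subset S -> #|Z| <= k.+1 -> F \subset dominated Z ->
  q \in S -> q \in dominated Z -> q \in F.
Proof.
move=> ZS Zk FZ qS qZ; have le := Y_min ZS Zk (dominated_far_or FZ).
have sub : S :\: dominated Z \subset S :\: dominated Y.
  apply/subsetP => r; rewrite !inE => /andP[rZ rS]; rewrite rS andbT.
  by apply: contra rZ => rY; apply: (subsetP FZ); rewrite inE rS.
have /eqP E : S :\: dominated Z == S :\: dominated Y by rewrite eqEcard sub.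
move/setP/(_ q): E; rewrite !inE qZ qS /= andbT.
by move/esym/negbFE.
Qed.

Variables (v : G) (X : {set G}).
Hypotheses (vX : pivot F v X) (Xk : #|X| <= k).

Let XF : X \subset F. Proof. by case: vX. Qed.
Let XS : X \subset S. Proof. exact: subset_trans XF FS. Qed.
Let vF : v \in F. Proof. by case: vX. Qed.
Let vS : v \in S. Proof. exact: (subsetP FS v vF). Qed.

Let U := F :\: N v.

Let UX : U \subset dominated X.
Proof.
apply/subsetP => q; rewrite inE => /andP[qv qF].
have := subsetP (pivot_dominated vX) q qF.
by rewrite dominatedU1 inE (negPf qv).
Qed.

Lemma inner_class p q : p \in F -> q \in U -> q \in N p ->
  exists2 x, x \in X & forall r, r \in U -> (r \in N p) = (r \in N x).
Proof.
move=> pF; rewrite inE => /andP[qv qF] qp.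
have [x xX hx] := (let: And3 _ _ h := vX in h) p q pF qF qp qv.
by exists x => // r; rewrite inE => /andP[rv rF]; apply: hx.
Qed.

Lemma card_swap x p : x \in X -> #|p |: X :\ x| <= k.
Proof.
move=> xX; apply: leq_trans Xk; rewrite [leqRHS](cardsD1 x) xX cardsU1 leq_add2r.
exact: leq_b1.
Qed.

Lemma swap_dominates x p : x \in X ->
  (forall r, r \in U -> (r \in N p) = (r \in N x)) ->
  U \subset dominated (p |: X :\ x).
Proof.
move=> xX hx; apply/subsetP => r rU; rewrite dominatedU1 inE hx //.
have /dominatedP[y yX ry] := subsetP UX r rU.
case: (eqVneq y x) => [<-|yx]; first by rewrite ry.
by apply/orP; right; apply/dominatedP; exists y => //; rewrite !inE yx.
Qed.

(* Replacing the representative of the class seen by [p] with [p] gives another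
   set dominating [F], which by minimality of [S :\: F] dominates nothing else. *)
Lemma inner_not_far p q r : p \in S -> q \in U -> q \in N p ->
  r \in S -> r \in N p -> r \in F.
Proof.
have main p' q' r' : p' \in F -> q' \in U -> q' \in N p' ->
    r' \in S -> r' \in N p' -> r' \in F.
  move=> pF qU qp rS rp; have [x xX hx] := inner_class pF qU qp.
  apply: (@cover_maximal (v |: (p' |: X :\ x))) => //.
  - rewrite !subUset !sub1set vS (subsetP FS) //=.
    exact: subset_trans (subsetDl _ _) XS.
  - rewrite cardsU1; apply: leq_trans (leq_add (leq_b1 _) (card_swap _ xX)) _.
    by rewrite add1n.
  - apply/subsetP => s sF; rewrite dominatedU1 inE.
    case: (boolP (s \in N v)) => //= sv.
    by apply: (subsetP (swap_dominates xX hx)); rewrite inE sv.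
  - by rewrite !dominatedU1 !in_setU rp orbT.
move=> pS qU qp; have qF : q \in F by move: qU; rewrite inE => /andP[].
have pF : p \in F by apply: (main q q) => //; rewrite ?nbhd_refl // nbhd_sym.
exact: main pF qU qp.
Qed.

(** If [F] were all of [S], then [v] and [X] would dominate [S] with [k.+1] vertices. *)
Lemma far_exists : exists2 q, q \in S & q \notin F.
Proof.
apply/subsetPn/negP => SF; apply: S_min; exists (v |: X); split.
- by rewrite subUset sub1set vS.
- by rewrite cardsU1; apply: leq_trans (leq_add (leq_b1 _) Xk) _; rewrite add1n.
- exact: subset_trans SF (pivot_dominated vX).
Qed.

Let T := S :\: U.

Let TS : T \subset S. Proof. exact: subsetDl. Qed.

Lemma outerE q : q \in S -> (q \in T) = (q \notin U).
Proof. by move=> qS; rewrite inE qS andbT. Qed.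

(** [v] dominates what [T] keeps of [F], and [d] the rest. That [d] itself lies in [T] follows from
    [inner_not_far], as [d] sees a vertex outside [F]. *)
Lemma outer_dominable : dominable T 2.
Proof.
have [r rS rF] := far_exists; have rd := far_dominated rS rF.
have dT : d \in T.
  rewrite outerE //; apply: contra rF => dU.
  exact: (inner_not_far dS dU (nbhd_refl d) rS rd).
have vT : v \in T by rewrite outerE // inE nbhd_refl.
exists (v |: [set d]); split.
- by rewrite subUset !sub1set vT.
- by rewrite cardsU1 cards1; case: (_ \notin _).
- apply/subsetP => q; rewrite inE => /andP[qU qS].
  rewrite dominatedU1 inE /dominated big_set1.
  move: qU; rewrite inE; case: (boolP (q \in N v)) => //= _.
  exact: far_dominated.
Qed.

Lemma outer_not_dominable : ~ dominable T 1.
Proof.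
case=> Z [ZT Z1 TZ]; apply: S_min; exists (Z :|: X); split.
- by rewrite subUset (subset_trans ZT).
- by apply: leq_trans (leq_card_setU _ _) _; rewrite -(add1n k) leq_add.
- apply/subsetP => q qS; rewrite /dominated bigcup_setU inE.
  case: (boolP (q \in U)) => [/(subsetP UX) ->|]; first by rewrite orbT.
  by rewrite -outerE // => /(subsetP TZ) ->.
Qed.

Variables (w : G) (X' : {set G}).
Hypotheses (wX : pivot T w X') (Xk' : #|X'| <= 1).

Let wS : w \in S.
Proof. by case: wX => /(subsetP TS). Qed.

Let X'S : X' \subset S.
Proof. by case: wX => _ /subset_trans->. Qed.

Lemma outer_class p q r : p \in T -> q \in T -> q \in N p -> q \notin N w ->
  r \in T -> r \notin N w -> r \in N p.
Proof.
move=> pT qT qp qw rT rw; case: wX => wT _ hX.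
have [x xX ->] // := hX p q pT qT qp qw.
have [y yX hy] := hX r r rT rT (nbhd_refl r) rw.
by rewrite (card_le1_eqP Xk' y x yX xX) -hy // nbhd_refl.
Qed.

(** The count is 2 + (k - 1): once two vertices dominate [T] and also take over the class of [x],
    the other representatives complete a dominating set too small for [S_min]. *)
Lemma no_double_class Z x : x \in X -> Z \subset S -> #|Z| <= 2 ->
  T \subset dominated Z -> U \subset dominated (Z :|: X :\ x) -> False.
Proof.
move=> xX ZS Z2 TZ UZ; apply: S_min; exists (Z :|: X :\ x); split.
- by rewrite subUset ZS (subset_trans (subsetDl _ _) XS).
- apply: leq_trans (leq_card_setU _ _) _; apply: leq_trans (leq_add Z2 (leqnn _)) _.
  by rewrite addSn ltnS; apply: leq_trans Xk; rewrite [leqRHS](cardsD1 x) xX.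
- apply/subsetP => q qS; case: (boolP (q \in U)) => [/(subsetP UZ) //|].
  by rewrite -outerE // /dominated bigcup_setU in_setU => /(subsetP TZ) ->.
Qed.

Lemma inner_nbhd_in_cover p q : p \in S -> q \in U -> q \in N p -> p \in F.
Proof. by move=> pS qU qp; exact: (inner_not_far pS qU qp pS (nbhd_refl p)). Qed.

(** Otherwise [p] could stand in for the representative of the class it sees. *)
Lemma outer_pair_not_inner Z p q : p \in Z -> Z \subset S -> #|Z| <= 2 ->
  T \subset dominated Z -> q \in U -> q \notin N p.
Proof.
move=> pZ ZS Z2 TZ qU; apply/negP => qp; have pS := subsetP ZS p pZ.
have [x xX hx] := inner_class (inner_nbhd_in_cover pS qU qp) qU qp.
apply: (no_double_class xX ZS Z2 TZ); apply: subset_trans (swap_dominates xX hx) _.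
rewrite dominatedU1 /dominated bigcup_setU setSU //.
exact: (bigcup_sup p pZ).
Qed.

Lemma pivot_pair p q : p \in T -> q \in T -> q \in N p -> q \notin N w ->
  T \subset dominated (w |: [set p]).
Proof.
move=> pT qT qp qw; apply/subsetP => r rT; rewrite dominatedU1 inE /dominated big_set1.
by case: (boolP (r \in N w)) => //= rw; apply: outer_class qp qw rT rw.
Qed.

Lemma card_pair p q : #|p |: [set q]| <= 2.
Proof. by rewrite cardsU1 cards1; case: (_ \notin _). Qed.

(** For [p] in [T], the pair of [w] and [p] dominates [T], so [outer_pair_not_inner] applies. *)
Lemma outer_not_inner p q r : p \in S -> q \in T -> q \in N p -> q \notin N w ->
  r \in U -> r \notin N p.
Proof.
have main p' q' r' : p' \in T -> q' \in T -> q' \in N p' -> q' \notin N w ->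
    r' \in U -> r' \notin N p'.
  move=> pT qT qp qw; apply: (outer_pair_not_inner _ _ (card_pair w p')).
  - by rewrite !inE eqxx orbT.
  - by rewrite subUset !sub1set wS (subsetP TS).
  - exact: pivot_pair qT qp qw.
move=> pS qT qp qw rU; case: (boolP (p \in T)) => [pT|].
  exact: main pT qT qp qw rU.
rewrite outerE // negbK => pU.
(* [q] sees itself and [p], so the settled case applies with [q] in the place of [p] and [p] in the
   place of [r]. *)
by have /negP[] := main q q p qT qT (nbhd_refl q) qw pU; rewrite nbhd_sym.
Qed.

(** Outside [N w], the classes are those of [X] on [U] and of [X'] on [T]; by [outer_not_inner] no
    vertex sees both kinds. *)
Lemma pivot_step : exists w X, pivot S w X /\ #|X| <= k.+1.
Proof.
exists w, (X :|: X'); split; last first.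
  by apply: leq_trans (leq_card_setU _ _) _; rewrite -addn1 leq_add.
split; [exact: wS | by rewrite subUset XS | move=> p q pS qS qp qw].
case: (boolP (q \in U)) => [qU|].
  have [x xX hx] := inner_class (inner_nbhd_in_cover pS qU qp) qU qp.
  exists x; first by rewrite inE xX.
  move=> r rS rw; case: (boolP (r \in U)) => [/hx //|]; rewrite -outerE // => rT.
  (* Both sides are false, since no vertex seeing [q] in [U] can see [r]. *)
  have off y : y \in S -> q \in N y -> r \notin N y.
    move=> yS qy; apply/negP => ry.
    by have /negP[] := outer_not_inner yS rT ry rw qU.
  by rewrite (negPf (off p pS qp)) (negPf (off x _ _)) -?hx // (subsetP XS).
rewrite -outerE // => qT.
have pT : p \in T.
  rewrite outerE //; apply/negP => pU.
  by have /negP[] := outer_not_inner pS qT qp qw pU; apply: nbhd_refl.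
have [x xX hx] := (let: And3 _ _ h := wX in h) p q pT qT qp qw.
exists x; first by rewrite inE xX orbT.
have qx : q \in N x by rewrite -hx.
move=> r rS rw; case: (boolP (r \in T)) => [/hx -> //|].
rewrite outerE // negbK => rU.
rewrite (negPf (outer_not_inner pS qT qp qw rU)).
by rewrite (negPf (outer_not_inner _ qT qx qw rU)) // (subsetP X'S).
Qed.

End Step.

(** * Existence of pivots by induction on the domination number *)

Lemma dominating_inhabited S Y k :
  Y \subset S -> S \subset dominated Y -> ~ dominable S k -> exists d, d \in Y.
Proof.
move=> YS SY S_min; apply/set0Pn/negP => /eqP E; apply: S_min; exists Y.
by rewrite YS SY E cards0.
Qed.

Lemma pivot_exists S k :
  (forall T, T \subset S -> dominable T 2 -> ~ dominable T 1 ->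
     exists w X, pivot T w X /\ #|X| <= 1) ->
  dominable S k.+1 -> ~ dominable S k -> exists w X, pivot S w X /\ #|X| <= k.
Proof.
elim: k S => [|k IH] S H2 [Y0 [Y0S Y0k SY0]] S_min;
  have [d dY0] := dominating_inhabited Y0S SY0 S_min.
  (* Base case: one vertex dominates [S], so it is a pivot that leaves no class. *)
  exists d, set0; rewrite cards0; split=> //; split; rewrite ?sub0set //.
    exact: (subsetP Y0S).
  have /eqP E : [set d] == Y0 by rewrite eqEcard sub1set dY0 cards1.
  by move=> p q _ /(subsetP SY0); rewrite -E /dominated big_set1 => ->.
(* Dominating sets with a distinguished vertex; the pair whose second component leaves the fewest
   vertices of [S] undominated provides [Y_min]. *)
pose P (c : G * {set G}) :=
  [&& c.1 \in S, c.2 \subset S, #|c.2| <= k.+1 & S \subset dominated (c.1 |: c.2)].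
have P0 : P (d, Y0 :\ d).
  rewrite /P /= (subsetP Y0S) // (subset_trans (subsetDl _ _)) // setD1K // SY0.
  by move: Y0k; rewrite (cardsD1 d) dY0 ltnS => ->.
case: (arg_minnP (fun c : G * {set G} => #|S :\: dominated c.2|) P0).
case=> d1 Y1 /and4P[/= d1S Y1S Y1k dom1] min1.
have Y1_min Z : Z \subset S -> #|Z| <= k.+1 -> S \subset dominated (d1 |: Z) ->
    #|S :\: dominated Y1| <= #|S :\: dominated Z|.
  by move=> ZS Zk SZ; apply: (min1 (d1, Z)); rewrite /P /= d1S ZS Zk SZ.
have [|||v [X [vX Xk]]] := IH (S :&: dominated Y1).
- by move=> T TF; apply: H2; apply: subset_trans TF (subsetIl _ _).
- exact: cover_dominable.
- exact: (cover_not_dominable S_min d1S).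
have [||w [X' [wX Xk']]] := H2 (S :\: ((S :&: dominated Y1) :\: N v)) (subsetDl _ _).
- exact: (outer_dominable S_min d1S dom1 Y1_min vX Xk).
- exact: (outer_not_dominable S_min vX Xk).
exact: (pivot_step S_min dom1 Y1_min vX Xk wX Xk').
Qed.

(** * Pivots and the length of the game *)

Lemma pivot_game_value w X A dom : pivot [set: G] w X -> w \in A ->
  game_value dom A <= #|[set x in X | legal A x]|.
Proof.
move=> [_ _ hX]; have [n] := ubnP #|[set x in X | legal A x]|.
elim: n dom A => // n IH dom A An wA.
rewrite game_valueE; case: pickP => [v0 v0A|//].
(* A move by either player makes the representative of its class illegal, and no representative
   becomes legal again. *)
have decr v : legal A v ->
    #|[set x in X | legal (v |: A) x]| < #|[set x in X | legal A x]|.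
  case/legalP => q qv qA.
  have off r : r \notin dominated A -> r \notin N w.
    by apply: contra => rw; apply/dominatedP; exists w.
  have [x xX hx] := hX v q (in_setT _) (in_setT _) qv (off q qA).
  apply/proper_card/properP; split.
    apply/subsetP => y; rewrite !inE => /andP[-> /legalP[r ry]] /=.
    rewrite dominatedU1 inE => /norP[_ rA].
    by apply/legalP; exists r.
  exists x; rewrite !inE xX /=.
    by apply/legalP; exists q; rewrite -?hx ?in_setT // off.
  apply/legalP=> -[r rx]; rewrite dominatedU1 inE => /norP[/negP rv rA].
  by apply: rv; rewrite hx ?in_setT // off.
have bound v : legal A v ->
    game_value (~~ dom) (v |: A) < #|[set x in X | legal A x]|.
  move=> vA; apply: leq_ltn_trans (decr v vA); apply: IH.
    by apply: leq_trans (decr v vA) _; rewrite -ltnS.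
  by rewrite inE wA orbT.
case: dom bound => bound /=.
  (* The default of the minimum is the value of the legal move [v0], so it obeys the same bound. *)
  elim/big_ind: _ => [|x y hx hy|v]; try exact: bound.
  by rewrite gtn_min hx.
have c0 := leq_ltn_trans (leq0n _) (bound v0 v0A).
rewrite -(prednK c0) ltnS; apply/bigmax_leqP => v vA.
by rewrite -ltnS prednK // bound.
Qed.

Lemma pivot_game_domination w X :
  pivot [set: G] w X -> game_domination_number G <= #|X|.+1.
Proof.
move=> wX; rewrite /game_domination_number game_valueE.
case: pickP => [v0 _|//]; rewrite ltnS.
have w0 : legal set0 w.
  by apply/legalP; exists w; rewrite ?nbhd_refl // /dominated big_set0 inE.
apply: leq_trans (bigminn_le_cond _ _ w0) _.
apply: leq_trans (pivot_game_value _ wX _) _; first exact: setU11.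
by apply/subset_leq_card/subsetP => x; rewrite inE => /andP[].
Qed.

Lemma game_value_eq0 dom A : (game_value dom A == 0) = [forall v, ~~ legal A v].
Proof.
rewrite game_valueE; case: pickP => [v vA|none].
  by apply/esym/negbTE/forallPn; exists v; rewrite negbK.
by rewrite eqxx; apply/esym/forallP => v; rewrite none.
Qed.

(** Dominator has a first move [w] after which at most one move remains; every legal second move
    then dominates all that is left, which makes at most one class. *)
Lemma game_domination2_pivot : 0 < #|G| -> game_domination_number G <= 2 ->
  exists w X, pivot [set: G] w X /\ #|X| <= 1.
Proof.
rewrite /game_domination_number game_valueE => /card_gt0P[g _].
case: pickP => [v0 v0A|/(_ g)/legalP[]]; last first.
  by exists g; rewrite ?nbhd_refl // /dominated big_set0 inE.
rewrite ltnS /= => le1.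
have [w] : exists w, game_value false (w |: set0) <= 1.
  elim/big_ind: _ le1 => [|x y hx hy|v _]; first by exists v0.
    by rewrite geq_min => /orP[/hx|/hy].
  by exists v.
rewrite setU0 game_valueE; case: pickP => [v1 v1w|none] /= le.
  exists w, [set v1]; rewrite cards1; split=> //; split; rewrite ?subsetT //.
  (* Staller's maximum is 0, so after any second move [p] no vertex is left undominated. *)
  have all_dom p r : legal [set w] p -> r \notin N w -> r \in N p.
    move=> pw rw; have : game_value true (p |: [set w]) == 0.
      by rewrite -leqn0; move: le; rewrite ltnS => /bigmax_leqP; apply.
    rewrite game_value_eq0 => /forallP/(_ r)/negbNE/subsetP/(_ r (nbhd_refl r)).
    by rewrite dominatedU1 inE /dominated big_set1 (negPf rw) orbF.
  move=> p q _ _ qp qw; exists v1; first exact: set11.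
  have pw : legal [set w] p by apply/legalP; exists q; rewrite // /dominated big_set1.
  by move=> r _ rw; rewrite (all_dom p r pw rw) (all_dom v1 r v1w rw).
exists w, set0; rewrite cards0; split=> //; split; rewrite ?sub0set //.
move=> p q _ _ qp qw; have /legalP[] := none p.
by exists q; rewrite // /dominated big_set1.
Qed.

Lemma domination_number_le Y :
  [set: G] \subset dominated Y -> domination_number G <= #|Y|.
Proof.
rewrite subTset /domination_number => GY.
by case: arg_minnP => [|Z _]; [rewrite /dominating -subTset sub_dominated | apply].
Qed.

Lemma domination_number_dominable : dominable [set: G] (domination_number G).
Proof.
rewrite /domination_number; case: arg_minnP => [|Y /eqP GY _].
  by rewrite /dominating -subTset sub_dominated.
by exists Y; rewrite subsetT GY.
Qed.

End Pivots.

(** * Transfer from an induced subgraph to its host graph *)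

Section Embedding.
Variables (G H : sgraph) (T : {set G}) (f : H -> G).
Hypotheses (f_inj : injective f) (f_adj : forall x y, adj (f x) (f y) = adj x y).
Hypothesis f_im : f @: [set: H] = T.

Lemma embedding_nbhd p q : (f q \in N (f p)) = (q \in N p).
Proof. by rewrite !inE f_adj (inj_eq f_inj). Qed.

Lemma embedding_onto p : p \in T -> exists p0, p = f p0.
Proof. by rewrite -f_im => /imsetP[p0 _ ->]; exists p0. Qed.

Lemma embedding_domination_number k : dominable T k -> domination_number H <= k.
Proof.
case=> Y [YT Yk TY]; apply: leq_trans (_ : #|f @^-1: Y| <= k).
  apply: domination_number_le; apply/subsetP => q _.
  have /(subsetP TY)/dominatedP[y yY qy] : f q \in T by rewrite -f_im imset_f.
  have [p yp] := embedding_onto (subsetP YT y yY).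
  by apply/dominatedP; exists p; rewrite -?embedding_nbhd -?yp // inE -yp.
rewrite -(card_imset _ f_inj); apply: leq_trans Yk; apply/subset_leq_card/subsetP.
by move=> _ /imsetP[p + ->]; rewrite inE.
Qed.

Lemma embedding_pivot w X : pivot [set: H] w X -> pivot T (f w) (f @: X).
Proof.
case=> _ _ hX; split; [by rewrite -f_im imset_f | by rewrite -f_im imsetS | ].
move=> _ _ /embedding_onto[p ->] /embedding_onto[q ->].
rewrite !embedding_nbhd => qp qw.
have [x xX hx] := hX p q (in_setT _) (in_setT _) qp qw.
exists (f x); first exact: imset_f.
by move=> _ /embedding_onto[r ->]; rewrite !embedding_nbhd; apply: hx.
Qed.

End Embedding.

Lemma game_perfect_pivot (G : sgraph) (T : {set G}) :
  T != set0 -> game_perfect (induced T) -> dominable T 2 ->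
  exists w X, pivot T w X /\ #|X| <= 1.
Proof.
move=> /set0Pn[t tT] perf T2.
(* Perfection of [induced T] speaks only of graphs induced in it, so [T] is realised by inducing
   twice; [f] composes the two inclusions. *)
pose H := induced [set: induced T].
pose f (x : H) : G := val (val x).
have f_inj : injective f by move=> x y /val_inj/val_inj.
have f_im : f @: [set: H] = T.
  apply/setP => p; apply/imsetP/idP => [[x _ ->]|pT]; first exact: valP (val x).
  by exists (exist _ (exist _ p pT : induced T) (in_setT _)).
have [h _] : exists2 h, h \in [set: H] & t = f h by apply/imsetP; rewrite f_im.
move=> _; have H0 : 0 < #|H| by apply/card_gt0P; exists h.
have le2 : game_domination_number H <= 2.
  rewrite (perf [set: induced T]); first exact: (embedding_domination_number f_inj _ f_im T2).
  by apply/set0Pn; exists (val h).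
have [w [X [wX X1]]] := game_domination2_pivot H0 le2.
exists (f w), (f @: X); split; first exact: embedding_pivot.
exact: leq_trans (leq_imset_card _ _) X1.
Qed.

Theorem theorem3p8 (G : sgraph) (hG : 0 < #|G|)
    (hmin : minimally_game_imperfect G) :
  domination_number G = 2.
Proof.
case: hmin => perf; apply: contraTeq => neq2; rewrite -leqNgt.
have := domination_number_dominable G; case E: (domination_number G) => [|k] Gk.
  case: Gk => Y [_]; rewrite leqn0 cards_eq0 => /eqP-> /subsetP sub.
  by have /card_gt0P[g _] := hG; have := sub g; rewrite /dominated big_set0 !inE => /(_ isT).
have le_dom j : dominable [set: G] j -> domination_number G <= j.
  by case=> Y [_ Yj /domination_number_le GY]; apply: leq_trans GY Yj.
have [||w [X [wX Xk]]] := pivot_exists _ Gk.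
- move=> T _ T2 T1.
  have T0 : T != set0.
    by apply/eqP => T0; apply: T1; exists set0; rewrite T0 !sub0set cards0.
  apply: (game_perfect_pivot T0 _ T2); apply: (perf T T0).
  (* [T] is proper: if it were the whole vertex set, [T1] and [T2] would give [G] domination number
     2. *)
  rewrite properEneq subsetT andbT; apply: contra neq2 => /eqP TT.
  rewrite TT in T1 T2; rewrite eqn_leq le_dom //= ltnNge; apply/negP => le1.
  case: (domination_number_dominable G) => Z [ZG Zk GZ].
  by apply: T1; exists Z; rewrite (leq_trans Zk).
- by move/le_dom; rewrite E ltnn.
by apply: leq_trans (pivot_game_domination wX) _.
Qed.
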